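(* Let $f(x)=x^6+c_5x^5+c_4x^4+c_3x^3+c_2x^2+c_1x+c_0$ be a monic polynomial of degree $6$ with integer coefficients. For every integer $q$, if $(c_0,c_1,c_2,c_3,c_4,c_5)$ equals one of the following: (1) $(1,\ -3q-9,\ 2q^2+15q+30,\ -3q^2-22q-42,\ q^2+12q+29,\ -2q-9)$; (2) $(1,\ -2q-3,\ q^2+4q+5,\ -q^2-4q-6,\ 3q+4,\ -q-3)$; (3) $(1,\ 2q-9,\ q^2-12q+29,\ -3q^2+22q-42,\ 2q^2-15q+30,\ 3q-9)$; (4) $(1,\ q-3,\ -3q+4,\ -q^2+4q-6,\ q^2-4q+5,\ 2q-3)$; then $f(x)$ is a Cappell-Shaneson polynomial which satisfies $c_5-c_1=q$.
   Context: For $n\ge 2$, a matrix $A\in\mathrm{SL}(n,\mathbb{Z})$ is a Cappell-Shaneson matrix of order $n$ if for every $k\in\{1,\ldots,[n/2]\}$ one has $\det(I-\bigwedge^kA)\in\{1,-1\}$, where $\bigwedge^k A$ is the $k$-th exterior power of $A$ and $I$ is the identity matrix. A monic integer polynomial of degree $n$ is a Cappell-Shaneson polynomial of degree $n$ if it is the characteristic polynomial of some Cappell-Shaneson matrix of order $n$. *)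

(* Defs.v *)
From mathcomp Require Import all_boot all_order all_algebra.

Set Implicit Arguments.
Unset Strict Implicit.
Unset Printing Implicit Defensive.

Import GRing.Theory.
Local Open Scope ring_scope.

(* The index set of the basis e_(i_1) /\ ... /\ e_(i_k), i_1 < ... < i_k, of
   the k-th exterior power of the free module of rank n; its cardinality
   'C(n, k) is card_ltn_sorted_tuples. *)
Definition ltn_tuples (n k : nat) : {set k.-tuple 'I_n} :=
  [set t : k.-tuple 'I_n | sorted ltn [seq val i | i <- t]].

(* In that basis, the entry (s, t) of the k-th exterior power of A is the minor
   of A on the rows s and the columns t. The basis is enumerated in the order
   of enum, the same for rows and columns. *)
Definition exterior_power (R : comNzRingType) (n k : nat) (A : 'M[R]_n) :
    'M[R]_#|ltn_tuples n k| :=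
  \matrix_(i, j) \det (mxsub (tnth (enum_val i)) (tnth (enum_val j)) A).

Definition Cappell_Shaneson_matrix (n : nat) (A : 'M[int]_n) : Prop :=
  [/\ (2 <= n)%N,
      \det A = 1
    & forall k : nat, (1 <= k <= n./2)%N ->
        \det (1%:M - exterior_power k A) = 1 \/
        \det (1%:M - exterior_power k A) = -1].

Definition Cappell_Shaneson_poly (n : nat) (f : {poly int}) : Prop :=
  [/\ f \is monic,
      size f = n.+1
    & exists A : 'M[int]_n, Cappell_Shaneson_matrix A /\ char_poly A = f].

(* Main.v *)
(* The companion matrix A of f has characteristic polynomial f and determinant
   f(0) = 1.  For each of the four families the entries of I - /\^k A are
   polynomials in q, and this matrix is invertible over Z[q]: multiplying it by
   its inverse shows that its determinant is a unit of Z for every q.  The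
   inverse is produced by the Faddeev-LeVerrier recursion; only the product is
   certified, so no property of that recursion has to be proved. *)
Require Import Defs.
From Stdlib Require Import ZArith.
From mathcomp Require Import all_boot all_order all_algebra.
From mathcomp Require Import ssrZ zify ring.

Import GRing.Theory.
Local Open Scope ring_scope.
(* MathComp binds the key Z to int_scope. *)
Delimit Scope Z_scope with ZZ.

(** * Computable polynomials and matrices over Z[q] *)

(* Coefficients in increasing degree, without trailing zeros. *)
Definition zpoly := seq Z.

(** Dropping a zero in front of the empty list keeps representations unique; otherwise [==] in
    [unimodular_check] could reject equal polynomials. *)
Definition zcons (a : Z) (p : zpoly) : zpoly :=
  if (a, p) is (Z0, [::]) then [::] else a :: p.

Fixpoint zadd (p r : zpoly) : zpoly :=
  match p, r with
  | [::], _ => r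
  | _, [::] => p
  | a :: p', b :: r' => zcons (Z.add a b) (zadd p' r')
  end.

Fixpoint zscale (a : Z) (p : zpoly) : zpoly :=
  if p is b :: p' then zcons (Z.mul a b) (zscale a p') else [::].

Fixpoint zmul (p r : zpoly) : zpoly :=
  if p is a :: p' then zadd (zscale a r) (zcons Z0 (zmul p' r)) else [::].

Definition zopp (p : zpoly) : zpoly := zscale (-1)%ZZ p.

Definition zsum (s : seq zpoly) : zpoly := foldr zadd [::] s.

Definition zbool (b : bool) : zpoly := if b then [:: 1%ZZ] else [::].

(* Laplace expansion along the first row. *)
Fixpoint zminor (a : nat -> nat -> zpoly) (s t : seq nat) : zpoly :=
  if s is i :: s' then
    zsum [seq zscale (if odd m then (-1)%ZZ else 1%ZZ)
                (zmul (a i (nth 0 t m))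
                      (zminor a s' (take m t ++ drop m.+1 t)))
         | m <- iota 0 (size t)]
  else [:: 1%ZZ].

Definition zmatrix := seq (seq zpoly).

Definition zentry (M : zmatrix) (i j : nat) : zpoly :=
  nth [::] (nth [::] M i) j.

Definition zmx (n : nat) (F : nat -> nat -> zpoly) : zmatrix :=
  mkseq (fun i => mkseq (F i) n) n.

Definition zmx1 (n : nat) : zmatrix := zmx n (fun i j => zbool (i == j)).

Definition zmulmx (n : nat) (M N : zmatrix) : zmatrix :=
  zmx n (fun i j =>
    zsum [seq zmul (zentry M i m) (zentry N m j) | m <- iota 0 n]).

(* One step maps N to M N + c I with c = - tr (M N) / (n - k). After the last
   one M N + c I = 0, where c is 1 or -1 when M is unimodular, so that the
   inverse of M is - c N. *)
Fixpoint faddeev_leverrier (n : nat) (M N : zmatrix) (k : nat) : zmatrix :=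
  let P := zmulmx n M N in
  let tr := zsum [seq zentry P i i | i <- iota 0 n] in
  let c := [seq Z.div x (Z.opp (Z.of_nat (n - k))) | x <- tr] in
  if k is k'.+1 then
    let N' := zmx n (fun i j =>
      zadd (zentry P i j) (if i == j then c else [::])) in
    faddeev_leverrier n M N' k'
  else zmx n (fun i j => zmul (zopp c) (zentry N i j)).

(** As the counter falls from n - 1 to 0, the divisor runs from 1 to n. The quotients are
    coefficients of the characteristic polynomial of [M], so the divisions are exact. *)
Definition zinvmx (n : nat) (M : zmatrix) : zmatrix :=
  faddeev_leverrier n M (zmx1 n) n.-1.

Fixpoint words (n k : nat) : seq (seq nat) :=
  if k is k'.+1 then [seq i :: w | i <- iota 0 n, w <- words n k']
  else [:: [::]].

Definition ltn_words (n k : nat) : seq (seq nat) :=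
  [seq w <- words n k | sorted ltn w].

(* cs lists the coefficients of a monic polynomial, except the leading 1. *)
Definition zcompanion (cs : seq zpoly) (i j : nat) : zpoly :=
  if i == (size cs).-1 then zopp (nth [::] cs j) else zbool (i.+1 == j).

Definition zsub1_exterior (cs : seq zpoly) (k : nat) : zmatrix :=
  let L := ltn_words (size cs) k in
  zmx (size L) (fun i j => zadd (zbool (i == j))
    (zopp (zminor (zcompanion cs) (nth [::] L i) (nth [::] L j)))).

Definition unimodular_check (cs : seq zpoly) (k : nat) : bool :=
  let M := zsub1_exterior cs k in
  zmulmx (size M) M (zinvmx (size M) M) == zmx1 (size M).

Definition families : seq (seq zpoly) :=
  [:: [:: [:: 1]; [:: -9; -3]; [:: 30; 15; 2]; [:: -42; -22; -3];
          [:: 29; 12; 1]; [:: -9; -2]];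
      [:: [:: 1]; [:: -3; -2]; [:: 5; 4; 1]; [:: -6; -4; -1];
          [:: 4; 3]; [:: -3; -1]];
      [:: [:: 1]; [:: -9; 2]; [:: 29; -12; 1]; [:: -42; 22; -3];
          [:: 30; -15; 2]; [:: -9; 3]];
      [:: [:: 1]; [:: -3; 1]; [:: 4; -3]; [:: -6; 4; -1];
          [:: 5; -4; 1]; [:: -3; 2]]]%ZZ.

(** The whole computation: twelve products of order 6, 15 or 20, with q an indeterminate so that one
    run covers every integer q. *)
Lemma families_unimodular :
  all (fun cs => all (unimodular_check cs) [:: 1; 2; 3]%N) families.
Proof. by vm_cast_no_check (erefl true). Qed.

(** * Evaluation at an integer *)

Definition zeval (q : int) (p : zpoly) : int :=
  foldr (fun a r => int_of_Z a + q * r) 0 p.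

Section Evaluation.

Variable q : int.
Local Notation ev := (zeval q).

Lemma zeval_cons a p : ev (zcons a p) = int_of_Z a + q * ev p.
Proof. by case: a p => [|a|a] [|b p] //=; rewrite mulr0. Qed.

Lemma zeval_add p r : ev (zadd p r) = ev p + ev r.
Proof.
elim: p r => [|a p IHp] [|b r] /=; rewrite ?add0r ?addr0 //.
by rewrite zeval_cons IHp (rmorphD int_of_Z) mulrDr addrACA.
Qed.

Lemma zeval_scale a p : ev (zscale a p) = int_of_Z a * ev p.
Proof.
elim: p => [|b p IHp] /=; first by rewrite mulr0.
by rewrite zeval_cons IHp (rmorphM int_of_Z) mulrDr mulrCA.
Qed.

Lemma zeval_mul p r : ev (zmul p r) = ev p * ev r.
Proof.
elim: p => [|a p IHp] /=; first by rewrite mul0r.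
by rewrite zeval_add zeval_cons zeval_scale IHp mulrDl mulrA add0r.
Qed.

Lemma zeval_opp p : ev (zopp p) = - ev p.
Proof. by rewrite zeval_scale mulN1r. Qed.

Lemma zeval_bool b : ev (zbool b) = b%:R.
Proof. by case: b => //=; rewrite mulr0 addr0. Qed.

Lemma zeval_sum (I : Type) (r : seq I) F :
  ev (zsum [seq F i | i <- r]) = \sum_(i <- r) ev (F i).
Proof.
by elim: r => [|i r IHr]; rewrite ?big_nil ?big_cons //= zeval_add IHr.
Qed.

Lemma zeval_minor a k s t : size s = k -> size t = k ->
  ev (zminor a s t) =
    \det (\matrix_(i < k, j < k) ev (a (nth 0%N s i) (nth 0%N t j))).
Proof.
elim: k s t => [|k IHk] [|x s] t //.
  by move=> _ _; rewrite det_mx00 /= mulr0 addr0.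
move=> [sz_s] sz_t; rewrite (expand_det_row _ ord0).
rewrite [zminor _ _ _]/= zeval_sum sz_t.
rewrite -[iota 0 k.+1]/(index_iota 0 k.+1) big_mkord.
apply: eq_bigr => j _; rewrite zeval_scale zeval_mul mulrCA !mxE.
rewrite /cofactor; congr (_ * _).
rewrite IHk //; last first.
  rewrite size_cat size_take size_drop sz_t; case: j => j /= lt_jk.
  by rewrite lt_jk subSS subnKC // -ltnS.
congr (_ * _); first by rewrite add0n -signr_odd; case: (odd j).
congr (\det _); apply/matrixP=> u v; rewrite !mxE /=; congr (ev (a _ _)).
(* Deleting entry j of [t] is reindexing along [lift j]: earlier positions stay, the others shift by
   one. *)
rewrite /bump; case: j => j /= lt_jk; rewrite nth_cat size_take sz_t lt_jk.
case: ltnP => [lt_vj|le_jv].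
  by rewrite nth_take // leqNgt lt_vj.
by rewrite nth_drop addSn subnKC // le_jv add1n.
Qed.

End Evaluation.

Lemma zentry_zmx n F i j :
  (i < n)%N -> (j < n)%N -> zentry (zmx n F) i j = F i j.
Proof. by move=> lt_in lt_jn; rewrite /zentry /zmx !nth_mkseq. Qed.

(** * The index set of the exterior power *)

Lemma mem_words n k w :
  (w \in words n k) = (size w == k) && all (fun i => i < n)%N w.
Proof.
elim: k w => [|k IHk] [|x w] //=; first by apply/allpairsP=> -[[i w] [_ _]].
apply/allpairsP/idP.
  move=> [[i v] /= [i_n v_k [-> ->]]].
  by move: i_n v_k; rewrite mem_iota IHk eqSS => /andP[_ ->] /andP[-> ->].
move=> /and3P[sz_w lt_xn lt_wn].
by exists (x, w); rewrite /= mem_iota IHk lt_xn lt_wn -eqSS sz_w.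
Qed.

Lemma uniq_words n k : uniq (words n k).
Proof.
elim: k => //= k IHk; apply: allpairs_uniq; rewrite ?iota_uniq //.
by move=> [i v] [j w] _ _ [-> ->].
Qed.

Section TupleWords.

Variables n k : nat.

Definition tuple_word (i : 'I_#|ltn_tuples n k|) : seq nat :=
  [seq val x | x <- enum_val i].

Lemma tuple_word_inj : injective tuple_word.
Proof. by move=> i j /(inj_map val_inj)/val_inj/enum_val_inj. Qed.

(** The order in which [enum_val] lists the tuples is never determined: a permutation is enough to
    reindex the sums in a matrix product. *)
Lemma perm_tuple_word :
  perm_eq [seq tuple_word i | i <- index_enum 'I_#|ltn_tuples n k|]
          (ltn_words n k).
Proof.
apply: uniq_perm.
- by rewrite (map_inj_uniq tuple_word_inj) index_enum_uniq.
- by rewrite filter_uniq ?uniq_words.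
move=> w; rewrite mem_filter mem_words; apply/mapP/and3P.
  move=> [i _ ->]; split.
  - by have := enum_valP i; rewrite inE.
  - by rewrite size_map size_tuple.
  - by apply/allP=> _ /mapP[x _ ->]; apply: ltn_ord.
move=> [w_lt sz_w /allP w_n].
have [t tE] : exists t : k.-tuple 'I_n, [seq val x | x <- t] = w.
  (* All entries of [w] are below n, so [insub] discards none of them. *)
  have szt : size (pmap insub w : seq 'I_n) == k.
    rewrite size_pmap_sub -(eqP sz_w) -all_count; exact/allP.
  exists (Tuple szt) => /=; rewrite (pmap_filter (insubK _)).
  by apply/all_filterP/allP=> x /w_n lt_xn; rewrite /= insubT.
have t_in : t \in ltn_tuples n k by rewrite inE tE.
exists (enum_rank_in t_in t); first by rewrite mem_index_enum.
by rewrite /tuple_word enum_rankK_in.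
Qed.

Lemma sum_tuple_word (F : seq nat -> int) :
  \sum_i F (tuple_word i) =
    \sum_(m < size (ltn_words n k)) F (nth [::] (ltn_words n k) m).
Proof.
rewrite -(big_map tuple_word predT F) (perm_big _ perm_tuple_word).
by rewrite (big_nth [::]) big_mkord.
Qed.

Lemma tuple_word_in i : tuple_word i \in ltn_words n k.
Proof. by rewrite -(perm_mem perm_tuple_word) map_f // mem_index_enum. Qed.

End TupleWords.

(** * Invertibility of I minus an exterior power over the integers *)

Lemma det_I_sub_exterior_power q cs k (A : 'M[int]_(size cs)) :
    (forall i j, A i j = zeval q (zcompanion cs i j)) ->
    unimodular_check cs k ->
  \det (1%:M - exterior_power k A) \is a GRing.unit.
Proof.
move=> AE; set n := size cs; set L := ltn_words n k; rewrite /unimodular_check.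
set M := zsub1_exterior cs k; have szM : size M = size L by rewrite size_mkseq.
rewrite szM; set N := zinvmx _ _ => /eqP MN1.
(* [ix] translates an index of the exterior power into the position of its word in [L]. *)
pose ix i := index (@tuple_word n k i) L.
have ix_lt i : (ix i < size L)%N by rewrite index_mem tuple_word_in.
have ix_nth m : (m < size L)%N -> index (nth [::] L m) L = m.
  by move=> lt_m; rewrite index_uniq // filter_uniq ?uniq_words.
have ix_eq i j : (ix i == ix j) = (i == j).
  apply/eqP/eqP => [/(index_inj [::]) eq_ij | -> //].
  by apply: (@tuple_word_inj n k); apply: eq_ij; apply: tuple_word_in.
(* The computed inverse, evaluated at q and reindexed; over a commutative ring a one-sided inverse
   suffices. *)
pose N' := \matrix_(i, j) zeval q (zentry N (ix i) (ix j)).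
suff MN' : (1%:M - exterior_power k A) *m N' = 1%:M.
  by have [] := mulmx1_unit MN'; rewrite unitmxE.
apply/matrixP=> i j; rewrite !mxE.
have entryM u v : (1%:M - exterior_power k A) u v =
    zeval q (zentry M (ix u) (ix v)).
  rewrite !mxE zentry_zmx // zeval_add zeval_opp zeval_bool ix_eq.
  congr (_ - _); rewrite !nth_index ?tuple_word_in //.
  rewrite (zeval_minor _ _ k) ?size_map ?size_tuple //.
  congr (\det _); apply/matrixP=> x y; rewrite !mxE AE.
  congr (zeval q (zcompanion _ _ _)).
    by rewrite (nth_map (tnth (enum_val u) x)) ?size_tuple // -tnth_nth.
  by rewrite (nth_map (tnth (enum_val v) y)) ?size_tuple // -tnth_nth.
(* The summand is made a function of the word alone, as [sum_tuple_word] requires. *)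
pose F w :=
  zeval q (zmul (zentry M (ix i) (index w L)) (zentry N (index w L) (ix j))).
transitivity (\sum_u F (@tuple_word n k u)).
  by apply: eq_bigr => u _; rewrite entryM mxE /F zeval_mul.
rewrite sum_tuple_word -ix_eq -(zeval_bool q).
rewrite -(zentry_zmx (size L) (fun i j => zbool (i == j))) //.
rewrite -[zmx _ _]/(zmx1 (size L)) -MN1 zentry_zmx //.
have -> : iota 0 (size L) = index_iota 0 (size L) by rewrite /index_iota subn0.
rewrite zeval_sum big_mkord.
by apply: eq_bigr => m _; rewrite /F ix_nth.
Qed.

(** * Companion matrices and the four families *)

Lemma exists_companion (p : {poly int}) n : p \is monic -> size p = n.+1 ->
  exists2 A : 'M[int]_n, char_poly A = p &
    forall i j,
      A i j = if i == n.-1 :> nat then - p`_j else (i.+1 == j :> nat)%:R.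
Proof.
move=> p_monic /(congr1 predn) /= sz_p; move: (companionmxK p_monic).
have AE i j : companionmx p i j =
    if i == (size p).-1.-1 :> nat then - p`_j else (i.+1 == j :> nat)%:R.
  by rewrite mxE.
(* The order [(size p).-1] occurs in the type of the matrix, which is generalized before rewriting
   it to [n]. *)
move: (companionmx p) AE; rewrite sz_p => A AE A_p; by exists A.
Qed.

Lemma Cappell_Shaneson_poly_of_unimodular q (cs : seq zpoly) (f : {poly int}) :
    (2 <= size cs)%N -> zeval q (nth [::] cs 0) = (-1) ^+ size cs ->
    f = rcons [seq zeval q c | c <- cs] 1 :> seq int ->
    all (unimodular_check cs) (iota 1 (size cs)./2) ->
  Cappell_Shaneson_poly (size cs) f.
Proof.
move=> cs_ge2 c0 fE /allP checks_cs.
have sz_f : size f = (size cs).+1 by rewrite fE size_rcons size_map.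
have f_monic : f \is monic.
  by rewrite monicE /lead_coef sz_f fE nth_rcons size_map ltnn eqxx.
have f_coef j : (j < size cs)%N -> f`_j = zeval q (nth [::] cs j).
  by move=> lt_j; rewrite fE nth_rcons size_map lt_j (nth_map [::]).
have [A A_f AE] := exists_companion _ _ f_monic sz_f.
split=> //; exists A; split=> //; split=> //.
  (* The constant coefficient is (-1)^n times the determinant; cancelling the sign gives determinant
     1. *)
  have := char_poly_det A; rewrite A_f f_coef ?(ltnW cs_ge2) // c0.
  by rewrite -{1}[(-1) ^+ _]mulr1 => /(mulrI (unitrX _ (unitrN1 _))).
move=> k /andP[k_gt0 le_k].
have : \det (1%:M - exterior_power k A) \is a GRing.unit.
  apply: det_I_sub_exterior_power; last first.
    by apply: checks_cs; rewrite mem_iota k_gt0 add1n ltnS.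
  move=> i j; rewrite AE /zcompanion; case: eqP => _; rewrite ?zeval_bool //.
  by rewrite zeval_opp f_coef.
by rewrite qualifE /= => /orP[]/eqP; [left | right].
Qed.

Theorem proposition6p6 (f : {poly int}) (c0 c1 c2 c3 c4 c5 : int)
  (hf : f = 'X^6 + c5 *: 'X^5 + c4 *: 'X^4 + c3 *: 'X^3 + c2 *: 'X^2
            + c1 *: 'X + c0%:P)
  (q : int)
  (hc : [\/ (c0, c1, c2, c3, c4, c5) =
              (1, - 3 * q - 9, 2 * q ^+ 2 + 15 * q + 30,
               - 3 * q ^+ 2 - 22 * q - 42, q ^+ 2 + 12 * q + 29, - 2 * q - 9),
            (c0, c1, c2, c3, c4, c5) =
              (1, - 2 * q - 3, q ^+ 2 + 4 * q + 5,
               - q ^+ 2 - 4 * q - 6, 3 * q + 4, - q - 3),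
            (c0, c1, c2, c3, c4, c5) =
              (1, 2 * q - 9, q ^+ 2 - 12 * q + 29,
               - 3 * q ^+ 2 + 22 * q - 42, 2 * q ^+ 2 - 15 * q + 30, 3 * q - 9)
          | (c0, c1, c2, c3, c4, c5) =
              (1, q - 3, - 3 * q + 4,
               - q ^+ 2 + 4 * q - 6, q ^+ 2 - 4 * q + 5, 2 * q - 3)]) :
  Cappell_Shaneson_poly 6 f /\ c5 - c1 = q.
Proof.
split; last by case: hc => -[_ -> _ _ _ ->]; ring.
have [cs cs_fam csE] : exists2 cs, cs \in families &
    [seq zeval q c | c <- cs] = [:: c0; c1; c2; c3; c4; c5].
  case: hc => -[-> -> -> -> -> ->];
    [ exists (nth [::] families 0) | exists (nth [::] families 1)
    | exists (nth [::] families 2) | exists (nth [::] families 3) ] => //;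
    by rewrite /zeval /=; do ![congr (_ :: _)]; lia.
have sz_cs : size cs = 6%N by rewrite -(size_map (zeval q)) csE.
(* This is the required constant term, since (-1)^6 = 1. *)
have c0E : c0 = 1 by case: hc => -[].
rewrite -{1}sz_cs; apply: (Cappell_Shaneson_poly_of_unimodular q);
  rewrite ?sz_cs //.
- by rewrite -(nth_map _ 0) ?sz_cs // csE c0E.
- have -> : f = Poly [:: c0; c1; c2; c3; c4; c5; 1].
    by apply/polyP=> -[|[|[|[|[|[|[|i]]]]]]]; rewrite hf !coefE /=; ring.
  by rewrite csE (@PolyK _ 1) //= oner_neq0.
- exact: (allP families_unimodular).
Qed.
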